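(* Let $m,n\ge1$ be integers and $a=2^{m(n+1)}$. Let $\mathfrak{D}$ be a general dyadic grid in $\mathbb{R}^n$ and let $f_1,\dots,f_m$ be nonnegative integrable functions on $\mathbb{R}^n$. For each $k\in\mathbb{Z}$ one can choose a family $\{Q_j^k\}_{j\in J_k}\subseteq\mathfrak{D}$ such that: (1) $a^k<\prod_{i=1}^m\frac1{|Q_j^k|}\int_{Q_j^k}f_i(y)\,dy\le 2^{mn}a^k$ for every $j\in J_k$; (2) the interiors of $\widetilde{Q_j^k}$, $j\in J_k$, are pairwise disjoint; (3) $\left\{(x,t)\in\mathbb{R}^{n+1}_+:\mathfrak{M}^{\mathfrak{D}}(\overrightarrow{f})(x,t)>a^k\right\}=\bigcup_{j\in J_k}\widetilde{Q_j^k}$. Furthermore, the family of cubes $\mathfrak{S}=\bigcup_{k,j}\{Q_j^k\}$ is sparse.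
   Context: Cubes have sides parallel to the coordinate axes; $|\cdot|$ is Lebesgue measure and $l(Q)$ is the side length of $Q$. A general dyadic grid $\mathfrak{D}$ is a collection of cubes in $\mathbb{R}^n$ such that: (i) every $Q\in\mathfrak{D}$ has side length of the form $2^k$, $k\in\mathbb{Z}$; (ii) $Q\cap R\in\{Q,R,\emptyset\}$ for all $Q,R\in\mathfrak{D}$; (iii) for each fixed $k\in\mathbb{Z}$, the cubes in $\mathfrak{D}$ of side length $2^k$ form a partition of $\mathbb{R}^n$. A family $\bigcup_{k,j}\{Q_j^k\}$ is sparse if: (i) for each fixed $k$ the cubes $Q_j^k$ are disjoint in $j$; (ii) with $\Omega_k=\bigcup_jQ_j^k$, one has $\Omega_{k+1}\subseteq\Omega_k$; (iii) $|\Omega_{k+1}\cap Q_j^k|\le\frac12|Q_j^k|$. $\mathbb{R}^{n+1}_+=\{(x,t):x\in\mathbb{R}^n,\ t\ge0\}$, and $\widetilde{Q}=\{(x,t)\in\mathbb{R}^{n+1}_+:x\in Q,\ 0\le t<l(Q)\}$. The dyadic multilinear maximal function on the upper half-space is, for $\overrightarrow{f}=(f_1,\dots,f_m)$ with $f_i\ge0$, $$\mathfrak{M}^{\mathfrak{D}}(\overrightarrow{f})(x,t)=\sup_{x\in Q\in\mathfrak{D},\ l(Q)\ge t}\ \prod_{i=1}^m\frac1{|Q|}\int_Q f_i(y)\,dy.$$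
   Formalization: In (3) the boxes on the right are taken with their top faces, i.e. Q×[0,l(Q)] instead of Q×[0,l(Q)), because the maximal function allows l(Q)=t; the equality with half-open boxes fails whenever the left-hand set is nonempty. *)

(* Defs.v *)
From HB Require Import structures.
From mathcomp Require Import all_boot all_order all_algebra.
From mathcomp Require Import all_classical all_reals all_analysis.

Set Implicit Arguments.
Unset Strict Implicit.
Unset Printing Implicit Defensive.

Import Order.TTheory GRing.Theory Num.Theory.
Import numFieldNormedType.Exports.

Local Open Scope classical_set_scope.
Local Open Scope ring_scope.

(* The product sigma-algebra on R^n. *)
Section rV_measurable.
Context {R : realType} {n : nat}.

Definition coord (i : 'I_n) (x : 'rV[R]_n) : R := x ord0 i.

Let rV_measurable0 : g_sigma_preimage coord set0.
Proof. exact: sigma_algebra0. Qed.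

Let rV_measurableC A : g_sigma_preimage coord A ->
  g_sigma_preimage coord (~` A).
Proof. exact: sigma_algebraC. Qed.

Let rV_measurable_bigcup (F : (set 'rV[R]_n)^nat) :
  (forall i, g_sigma_preimage coord (F i)) ->
  g_sigma_preimage coord (\bigcup_i F i).
Proof. exact: sigma_algebra_bigcup. Qed.

HB.instance Definition _ :=
  @isMeasurable.Build (measure_tuple_display default_measure_display)
    'rV[R]_n (g_sigma_preimage coord)
    rV_measurable0 rV_measurableC rV_measurable_bigcup.

Lemma measurable_coord (i : 'I_n) : measurable_fun [set: 'rV[R]_n] (coord i).
Proof.
move=> _ Y mY; rewrite setTI; apply: sub_sigma_algebra => /=.
rewrite -bigcup_seq/=; exists i => /=; first by rewrite mem_index_enum.
by exists Y => //; rewrite setTI.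
Qed.

Lemma measurable_fun_coordP d (T : measurableType d) (f : T -> 'rV[R]_n) :
  (forall i, measurable_fun [set: T] (coord i \o f)) ->
  measurable_fun [set: T] f.
Proof.
move=> mf; pose G := \big[setU/set0]_(i < n)
  preimage_set_system [set: 'rV[R]_n] (coord i) measurable.
apply: (@measurability _ _ _ _ _ _ G) => // _ [B + <-].
rewrite /G -bigcup_seq => -[i _ [C mC <-]].
by rewrite [X in _ `&` (_ @^-1` X)]setTI; exact: mf.
Qed.

End rV_measurable.

Section rV_cons.
Context {R : realType} {n : nat}.

Definition rV_cons (p : R * 'rV[R]_n) : 'rV[R]_n.+1 :=
  \row_i (if unlift ord0 i is Some j then p.2 ord0 j else p.1).

Lemma measurable_rV_cons : measurable_fun setT rV_cons.
Proof.
apply: measurable_fun_coordP => i.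
have -> : coord i \o rV_cons =
    fun p => if unlift ord0 i is Some j then coord j p.2 else p.1.
  by apply/funext => p; rewrite /= /coord mxE.
case: unliftP => [j _|_]; last exact: measurable_fst.
by apply: (measurableT_comp (measurable_coord j)); exact: measurable_snd.
Qed.

Variable mu : {sigma_finite_measure set 'rV[R]_n -> \bar R}.

Definition measure_cons : set 'rV[R]_n.+1 -> \bar R :=
  pushforward (@lebesgue_measure R \x mu)%E rV_cons.

Let measure_cons0 : measure_cons set0 = 0%E.
Proof. by rewrite /measure_cons /pushforward preimage_set0 measure0. Qed.

Let measure_cons_ge0 A : (0 <= measure_cons A)%E.
Proof. exact: (measure_ge0 (@lebesgue_measure R \x mu)%E). Qed.

Let measure_cons_sigma_additive : semi_sigma_additive measure_cons.
Proof.
rewrite /measure_cons.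
by apply: measure_semi_sigma_additive; exact: measurable_rV_cons.
Qed.

HB.instance Definition _ := isMeasure.Build _ _ _ measure_cons
  measure_cons0 measure_cons_ge0 measure_cons_sigma_additive.

Let measure_cons_sigma_finite : sigma_finite setT measure_cons.
Proof.
have /sigma_finiteP[F [FT ndF mF]] := sigma_finiteT (@lebesgue_measure R).
have /sigma_finiteP[G [GT ndG mG]] := sigma_finiteT mu.
pose tl (x : 'rV[R]_n.+1) : R * 'rV[R]_n :=
  (x ord0 ord0, \row_j x ord0 (lift ord0 j)).
have tlK : cancel tl rV_cons.
  move=> x; apply/rowP => i; rewrite mxE.
  by case: unliftP => [j ->|->] //=; rewrite mxE.
have consK : cancel rV_cons tl.
  move=> [a x]; rewrite /tl !mxE unlift_none; congr pair.
  by apply/rowP => j; rewrite !mxE liftK.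
have mtl : measurable_fun setT tl.
  apply: measurable_fun_pair; first exact: (measurable_coord ord0).
  apply: measurable_fun_coordP => j.
  rewrite (_ : _ \o _ = coord (lift ord0 j)); first exact: measurable_coord.
  by apply/funext => x; rewrite /= /coord mxE.
exists (fun k => tl @^-1` (F k `*` G k)).
  rewrite -preimage_bigcup; apply/esym/seteqP; split => // x _.
  have : setT (tl x).1 by [].
  have : setT (tl x).2 by [].
  rewrite {1}GT FT => -[k _ Gk] [l _ Fl]; exists (maxn k l) => //; split.
    by move: Fl; exact/subsetPset/ndF/leq_maxr.
  by move: Gk; exact/subsetPset/ndG/leq_maxl.
move=> k; have [mFk Fkoo] := mF k; have [mGk Gkoo] := mG k; split.
  by rewrite -[X in measurable X]setTI; apply: mtl => //; exact: measurableX.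
rewrite /measure_cons /pushforward -comp_preimage.
rewrite (_ : tl \o rV_cons = id); last by apply/funext => p; exact: consK.
rewrite preimage_id product_measure1E//.
by rewrite lte_mul_pinfty// ge0_fin_numE.
Qed.

HB.instance Definition _ := Measure_isSigmaFinite.Build _ _ _ measure_cons
  measure_cons_sigma_finite.

End rV_cons.

(* The n-fold product of the Lebesgue measure of R, on the product
   sigma-algebra, i.e. the Lebesgue measure on the Borel sets of R^n. *)
Fixpoint borel_lebesgue (R : realType) (n : nat) :
    {sigma_finite_measure set 'rV[R]_n -> \bar R} :=
  match n with
  | 0 => \d_(0 : 'rV[R]_0)
  | n'.+1 => measure_cons (borel_lebesgue R n')
  end.

(* Its completion, on the sigma-algebra of all Lebesgue measurable sets. *)
Definition lebesgue (R : realType) (n : nat) :=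
  @completed_measure_extension _ _ _ (borel_lebesgue R n).
Arguments lebesgue : clear implicits.
HB.instance Definition _ (R : realType) (n : nat) :=
  Measure.on (lebesgue R n).

Lemma measurable_box (R : realType) (n : nat) (I : 'I_n -> interval R) :
  measurable [set x : 'rV[R]_n | forall i, x ord0 i \in I i].
Proof.
have -> : [set x : 'rV[R]_n | forall i, x ord0 i \in I i] =
    \bigcap_i (coord i @^-1` [set` I i]).
  by apply/seteqP; split => x /= Ix i; [move=> _|]; exact: Ix.
apply: fin_bigcap_measurable; first exact: finite_finset.
move=> i _; rewrite -[X in measurable X]setTI.
by apply: measurable_coord => //; exact: measurable_itv.
Qed.

Lemma borel_lebesgue_box (R : realType) (n : nat) (I : 'I_n -> interval R) :
  borel_lebesgue R n [set x | forall i, x ord0 i \in I i] =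
  (\prod_(i < n) @lebesgue_measure R [set` I i])%E.
Proof.
elim: n I => [I|n IHn I] /=.
  rewrite big_ord0 diracE mem_set// => -[] //.
rewrite big_ord_recl /= /measure_cons /pushforward.
rewrite -(IHn (fun i => I (lift ord0 i))).
rewrite -product_measure1E //; first last.
  exact: measurable_box.
congr (product_measure1 _ _ _); apply/seteqP; split => -[a x] /=.
  move=> Ix; split; first by have := Ix ord0; rewrite mxE unlift_none.
  by move=> i; have := Ix (lift ord0 i); rewrite mxE liftK.
move=> [Ia Ix] i; rewrite mxE; case: unliftP => [j ->|->] //=.
Qed.

Lemma lebesgue_box (R : realType) (n : nat) (I : 'I_n -> interval R) :
  lebesgue R n [set x | forall i, x ord0 i \in I i] =
  (\prod_(i < n) @lebesgue_measure R [set` I i])%E.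
Proof.
rewrite -borel_lebesgue_box /lebesgue /completed_measure_extension.
by rewrite measurable_mu_extE//; exact: measurable_box.
Qed.

Section cubes.
Context {R : realType} {n : nat}.

(* Each side is a bounded interval of length [side] with endpoints included or
   not as prescribed by [lclosed] and [rclosed]; open, closed and half-open
   cubes are all covered. *)
Record cube := Cube {
  corner : 'rV[R]_n;
  side : R;
  side_gt0 : 0 < side;
  lclosed : 'I_n -> bool;
  rclosed : 'I_n -> bool }.

Definition cube_itv (Q : cube) (i : 'I_n) : interval R :=
  Interval (BSide (lclosed Q i) (corner Q ord0 i))
           (BSide (~~ rclosed Q i) (corner Q ord0 i + side Q)).

Definition cube_set (Q : cube) : set 'rV[R]_n :=
  [set x | forall i, x ord0 i \in cube_itv Q i].

Lemma lebesgue_cube (Q : cube) :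
  lebesgue R n (cube_set Q) = (side Q ^+ n)%:E.
Proof.
rewrite lebesgue_box (eq_bigr (fun=> (side Q)%:E)) => [|i _].
  by rewrite prodEFin prodr_const card_ord.
rewrite lebesgue_measure_itv /= lte_fin ltrDl side_gt0.
by rewrite -EFinB addrAC subrr add0r.
Qed.

Definition dyadic_grid (D : set cube) : Prop :=
  [/\ forall Q, D Q -> exists k : int, side Q = 2 ^ k,
      forall P Q, D P -> D Q ->
        [\/ cube_set P `&` cube_set Q = cube_set P,
            cube_set P `&` cube_set Q = cube_set Q |
            cube_set P `&` cube_set Q = set0]
    & forall k : int,
        partition [set Q | D Q /\ side Q = 2 ^ k] cube_set [set: 'rV[R]_n]].

Definition layer (S : set cube) : set 'rV[R]_n :=
  \bigcup_(Q in S) cube_set Q.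

Definition sparse (S : int -> set cube) : Prop :=
  [/\ forall k, trivIset (S k) cube_set,
      forall k, layer (S (k + 1)) `<=` layer (S k)
    & forall k Q, S k Q ->
        (lebesgue R n (layer (S (k + 1)%R) `&` cube_set Q) <=
         (2^-1)%:E * lebesgue R n (cube_set Q))%E].

Definition upper_half_space : set ('rV[R]_n * R) := [set p | 0 <= p.2].

Definition tent (Q : cube) : set ('rV[R]_n * R) :=
  [set p | cube_set Q p.1 /\ 0 <= p.2 < side Q].

(* The maximal function below admits cubes with [side Q] equal to [t], so its
   superlevel sets contain the top faces of the half-open boxes [tent Q]. *)
Definition tent_top (Q : cube) : set ('rV[R]_n * R) :=
  [set p | cube_set Q p.1 /\ p.2 = side Q].

Definition average (f : 'rV[R]_n -> R) (Q : cube) : \bar R :=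
  ((lebesgue R n (cube_set Q))^-1 *
   \int[lebesgue R n]_(y in cube_set Q) (f y)%:E)%E.

Definition average_prod (m : nat) (f : 'I_m -> 'rV[R]_n -> R) (Q : cube) :
  \bar R := (\prod_(i < m) average (f i) Q)%E.

Definition dyadic_maximal (m : nat) (D : set cube)
    (f : 'I_m -> 'rV[R]_n -> R) (p : 'rV[R]_n * R) : \bar R :=
  ereal_sup [set average_prod f Q |
    Q in [set Q | [/\ D Q, cube_set Q p.1 & p.2 <= side Q]]].

End cubes.

Arguments cube : clear implicits.

(* Main.v *)
(* [S k] consists of the maximal cubes of the grid on which the product of the
   averages exceeds [a ^ k]. They exist because the product of the averages is
   at most a constant over [|Q| ^ m], and comparison with the dyadic parent
   bounds it by [2 ^ (m * n) * a ^ k] on a maximal cube [Q]. A cube [P] of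
   [S (k + 1)] inside [Q] has a product of averages at least [2 ^ m] times that
   of [Q], so by the arithmetic-geometric mean inequality [2 |P| / |Q|] is at
   most the mean over [i] of [\int_P f_i / \int_Q f_i]. Summing over the
   disjoint cubes [P] gives sparseness. *)

Require Import Defs.
From mathcomp Require Import all_boot all_order all_algebra.
From mathcomp Require Import all_classical all_reals all_analysis.
From mathcomp Require Import measurable_realfun ring.

Set Implicit Arguments.
Unset Strict Implicit.
Unset Printing Implicit Defensive.

Import Order.TTheory GRing.Theory Num.Theory.
Import numFieldNormedType.Exports.

Local Open Scope classical_set_scope.
Local Open Scope ring_scope.

(** * Integral estimates over countable disjoint unions *)

Lemma le_measure_integral_bigcup d (T : measurableType d) (R : realType)
    (mu : {measure set T -> \bar R}) (I : Type) (S : set I) (F : I -> set T)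
    (g : T -> \bar R) (c : R) :
  countable S -> trivIset S F -> (forall i, S i -> measurable (F i)) ->
  measurable_fun setT g -> (forall x, 0 <= g x)%E -> 0 <= c ->
  (forall i, S i -> (c%:E * mu (F i) <= \int[mu]_(x in F i) g x)%E) ->
  measurable (\bigcup_(i in S) F i) /\
  (c%:E * mu (\bigcup_(i in S) F i) <=
   \int[mu]_(x in \bigcup_(i in S) F i) g x)%E.
Proof.
move=> /countable_injP[e e_inj] tF mF mg g0 c0 cF.
(* The injection [e] into the naturals turns the family into a sequence, with [G k] empty when [k]
   is not a code; countable additivity of measure and integral then reduces the claim to single
   terms. *)
pose G (k : nat) := \bigcup_(i in [set i | S i /\ e i = k]) F i.
have GP k : G k = set0 \/ exists2 i, S i & G k = F i.
  have [[i [Si eik]]|noi] := pselect (exists i, S i /\ e i = k); [right|left].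
    exists i => //; apply/seteqP; split => [x [j [Sj ejk] Fjx]|x Fix].
      suff -> : i = j by [].
      by apply: e_inj; rewrite ?inE// ejk.
    by exists i.
  by apply/seteqP; split => // x [j [Sj ejk] _]; case: noi; exists j.
have UG : \bigcup_(i in S) F i = \bigcup_k G k.
  apply/seteqP; split => x.
    by move=> [i Si Fix]; exists (e i) => //; exists i.
  by move=> [k _ [i [Si _] Fix]]; exists i.
have mG k : measurable (G k) by case: (GP k) => [->//|[i Si ->]]; exact: mF.
have tG : trivIset setT G.
  move=> k l _ _ [x [[i [Si <-] Fix] [j [Sj <-] Fjx]]].
  by congr e; apply: tF => //; exists x.
rewrite UG; split; first exact: bigcup_measurable.
rewrite measure_bigcup// ge0_integral_bigcup//; last exact: measurable_funTS.
under eq_eseriesl do rewrite in_setT.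
rewrite -nneseriesZl//; apply: lee_nneseries => [k _ _|k _].
  by rewrite mule_ge0.
case: (GP k) => [->|[i Si ->]]; last exact: cF.
by rewrite measure0 mule0 integral_set0.
Qed.

(** * Cubes and dyadic grids *)

Section cube_facts.
Context {R : realType} {n : nat}.
Implicit Types (P Q : cube R n) (D : set (cube R n)).

Lemma measurable_cube Q :
  measurable (cube_set Q : set (caratheodory_type (borel_lebesgue R n)^*%mu)).
Proof.
by apply: sub_caratheodory; apply: sub_sigma_algebra; exact: measurable_box.
Qed.

Lemma cube_rational Q : exists q : 'rV[rat]_n, cube_set Q (map_mx ratr q).
Proof.
have /choice[q qP] (i : 'I_n) : exists q : rat,
    ratr q \in `]corner Q ord0 i, corner Q ord0 i + side Q[.
  by apply: rat_in_itvoo; rewrite ltrDl side_gt0.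
exists (\row_i q i) => i; rewrite !mxE.
have := qP i; rewrite itv_boundlr => /andP[lq qr].
rewrite /cube_itv; apply/andP; split.
  by case: (lclosed Q i); rewrite bnd_simp// ltW.
by case: (rclosed Q i); rewrite bnd_simp// ltW.
Qed.

Lemma le_side_cube P Q : (0 < n)%N -> cube_set P `<=` cube_set Q ->
  side P <= side Q.
Proof.
move=> n_gt0 PQ.
have : (lebesgue R n (cube_set P) <= lebesgue R n (cube_set Q))%E.
  by apply: le_measure => //; rewrite inE; exact: measurable_cube.
by rewrite !lebesgue_cube lee_fin ler_pXn2r// nnegrE ltW// side_gt0.
Qed.

(** The partition is indexed by cubes, so its disjointness yields equality of records and not merely
    of point sets. *)
Lemma dyadic_grid_inj D : dyadic_grid D ->
  forall P Q, D P -> D Q -> side P = side Q ->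
  cube_set P `&` cube_set Q !=set0 -> P = Q.
Proof.
move=> [D2 _ Dpart] P Q DP DQ sPQ PQ.
have [k sPk] := D2 P DP; have [_ tD _] := Dpart k.
by apply: tD => //=; split=> //; rewrite -sPQ.
Qed.

Lemma dyadic_grid_sub D : (0 < n)%N -> dyadic_grid D ->
  forall P Q, D P -> D Q -> side P <= side Q ->
  cube_set P `&` cube_set Q !=set0 -> cube_set P `<=` cube_set Q.
Proof.
move=> n_gt0 gD P Q DP DQ sPQ PQ0; have [_ Dnest _] := gD.
case: (Dnest P Q DP DQ) => [/setIidPl //|/setIidPr QP|PQ]; last first.
  by move: PQ0; rewrite PQ => -[].
(* Here [Q] lies in [P], so comparing volumes forces equal sides. *)
suff -> : P = Q by [].
apply: (dyadic_grid_inj gD) => //; apply/eqP.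
by rewrite eq_le sPQ le_side_cube.
Qed.

(** A grid cube is determined by its generation and any rational point inside it. *)
Lemma dyadic_grid_countable D : dyadic_grid D -> countable D.
Proof.
move=> gD; have [D2 _ _] := gD.
have /choice[q qP] := cube_rational.
have /choice[k kP] Q : exists k : int, D Q -> side Q = 2 ^ k.
  have [/D2[k Dk]|nD] := pselect (D Q); first by exists k.
  by exists 0 => /nD.
apply/countable_injP; exists (fun Q => pickle (k Q, q Q)).
move=> P Q /set_mem DP /set_mem DQ /(pcan_inj pickleK)[kPQ qPQ].
apply: (dyadic_grid_inj gD) => //; first by rewrite !kP// kPQ.
by exists (map_mx ratr (q P)); split; rewrite ?[in X in cube_set Q X]qPQ.
Qed.

Lemma dyadic_grid_ancestor D : (0 < n)%N -> dyadic_grid D ->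
  forall Q, D Q -> forall j : nat, exists P,
  [/\ D P, side P = side Q * 2 ^+ j & cube_set Q `<=` cube_set P].
Proof.
move=> n_gt0 gD Q DQ j; have [D2 _ Dpart] := gD.
have [k sQ] := D2 Q DQ; have [q qQ] := cube_rational Q.
(* The ancestor is the cube [j] generations up through a rational point of [Q]; nesting makes it
   contain [Q]. *)
have [cov _ _] := Dpart (k + j%:Z).
have : [set: 'rV[R]_n] (map_mx ratr q) by [].
rewrite -cov => -[P [DP sP] qP].
have sPQ : side P = side Q * 2 ^+ j.
  by rewrite sP sQ exprzDr ?unitfE// exprnP.
exists P; split=> //; apply: (dyadic_grid_sub n_gt0 gD) => //.
  rewrite sPQ ler_peMr//; first exact/ltW/side_gt0.
  by rewrite exprn_ege1// ler1n.
by exists (map_mx ratr q).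
Qed.

End cube_facts.

(** * Averages and the packing estimate *)

Section averages.
Context {R : realType} {m n : nat} (f : 'I_m -> 'rV[R]_n -> R).
Hypothesis f_ge0 : forall i x, 0 <= f i x.
Hypothesis f_int : forall i, (lebesgue R n).-integrable setT (EFin \o f i).
Implicit Types (P Q : cube R n) (S : set (cube R n)) (c l : R) (i : 'I_m).

Local Notation lebesgueT := (caratheodory_type (borel_lebesgue R n)^*%mu).

Definition mass i Q : R :=
  fine (\int[lebesgue R n]_(y in cube_set Q) (f i y)%:E).

Definition mean_prod Q : R := \prod_i (mass i Q / side Q ^+ n).

Let mf i : measurable_fun [set: lebesgueT] (EFin \o f i).
Proof. by have /integrableP[] := f_int i. Qed.

Let f0 i x : (0 <= (f i x)%:E)%E. Proof. by rewrite lee_fin. Qed.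

Lemma massE i Q :
  (\int[lebesgue R n]_(y in cube_set Q) (f i y)%:E = (mass i Q)%:E)%E.
Proof.
rewrite fineK//; apply: integrable_fin_num; first exact: measurable_cube.
by apply: (integrableS _ _ _ (f_int i)) => //; exact: measurable_cube.
Qed.

Lemma mass_ge0 i Q : 0 <= mass i Q.
Proof. by rewrite -lee_fin -massE integral_ge0. Qed.

Lemma le_mass i P Q : cube_set P `<=` cube_set Q -> mass i P <= mass i Q.
Proof.
move=> PQ; rewrite -lee_fin -!massE.
apply: (ge0_subset_integral _ (measurable_cube P) (measurable_cube Q) _ _ PQ).
  exact: measurable_funTS (mf i).
by move=> x _; exact: f0.
Qed.

(** A bound independent of the cube makes products of averages decay as cubes grow, which limits the
    search for maximal cubes. *)
Lemma mass_bounded : exists2 M : R, 0 <= M & forall Q, \prod_i mass i Q <= M.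
Proof.
exists (\prod_i fine (\int[lebesgue R n]_y (f i y)%:E)).
  by apply: prodr_ge0 => i _; rewrite fine_ge0// integral_ge0.
move=> Q; apply: ler_prod => i _; rewrite mass_ge0/= -lee_fin -massE fineK.
  apply: (ge0_subset_integral _ (measurable_cube Q) measurableT _ _
    (@subsetT _ _)).
    exact: mf.
  by move=> x _; exact: f0.
exact: (integrable_fin_num measurableT (f_int i)).
Qed.

Lemma average_prodE Q : average_prod f Q = (mean_prod Q)%:E.
Proof.
rewrite /average_prod /mean_prod -prodEFin; apply: eq_bigr => i _.
rewrite /average massE lebesgue_cube.
by rewrite inver gt_eqF ?exprn_gt0 ?side_gt0// -EFinM mulrC.
Qed.

Lemma mean_prodE Q :
  mean_prod Q = \prod_i mass i Q / (side Q ^+ n) ^+ m.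
Proof. by rewrite /mean_prod big_split/= prodr_const card_ord exprVn. Qed.

(** Masses can only increase from [P] to [Q], while each of the [m] volumes is multiplied by
    [c ^+ n]. *)
Lemma mean_prod_le_sub P Q c : 0 < c -> side Q = side P * c ->
  cube_set P `<=` cube_set Q -> mean_prod P <= c ^+ (m * n) * mean_prod Q.
Proof.
move=> c0 sQ PQ.
have -> : c ^+ (m * n) = \prod_(i < m) c ^+ n.
  by rewrite prodr_const card_ord -exprM mulnC.
rewrite -big_split/=; apply: ler_prod => i _.
have sP0 := exprn_gt0 n (side_gt0 P).
rewrite divr_ge0 ?mass_ge0 ?(ltW sP0)//= sQ exprMn.
rewrite mulrCA invfM [_^-1 * _]mulrC mulVKf ?gt_eqF ?exprn_gt0//.
by rewrite ler_pM2r ?invr_gt0// le_mass.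
Qed.

(* The arithmetic-geometric mean inequality replaces Hölder's inequality: it
   bounds the measure of each cube of [S] by the integral of a single weighted
   sum of the [f i], which is additive over disjoint cubes. *)
Lemma packing S Q c : (0 < m)%N -> countable S -> trivIset S cube_set ->
  (forall P, S P -> cube_set P `<=` cube_set Q) -> 0 <= c ->
  0 < mean_prod Q -> (forall P, S P -> c ^+ m * mean_prod Q <= mean_prod P) ->
  (c%:E * lebesgue R n (layer S) <= lebesgue R n (cube_set Q))%E.
Proof.
move=> m_gt0 cS tS SQ c0 Q0 cSQ.
have sQ0 := exprn_gt0 n (side_gt0 Q).
have m0 : 0 < m%:R :> R by rewrite ltr0n.
have mass0 i : 0 < mass i Q.
  rewrite lt_neqAle mass_ge0 andbT eq_sym; apply/eqP => Qi0.
  by move: Q0; rewrite /mean_prod (bigD1 i)//= Qi0 !mul0r ltxx.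
(* With these weights each term of [g] has integral [|Q| / m] over [Q], so [g] has integral [|Q|]
   there; over [P] its integral is [|Q|] times the mean of the mass ratios. *)
pose w i := side Q ^+ n / m%:R / mass i Q.
have w0 i : 0 <= w i by rewrite !divr_ge0// ltW.
pose g x := (\sum_i (w i)%:E * (f i x)%:E)%E.
have mwf i : measurable_fun [set: lebesgueT] (fun x => (w i)%:E * (f i x)%:E)%E.
  exact: measurable_funeM (mf i).
have intg P : (\int[lebesgue R n]_(x in cube_set P) g x =
    (\sum_i w i * mass i P)%:E)%E.
  rewrite (ge0_integral_sum _ (measurable_cube P)); last 2 first.
  - by move=> i; exact: measurable_funTS (mwf i).
  - by move=> i x _; rewrite mule_ge0// lee_fin.
  rewrite -sumEFin; apply: eq_bigr => i _.
  rewrite (ge0_integralZl_EFin _ (measurable_cube P) (fun x _ => f0 i x)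
    (measurable_funTS (mf i)) (w0 i)).
  by rewrite massE.
have g0 x : (0 <= g x)%E by apply: sume_ge0 => i _; rewrite mule_ge0// lee_fin.
have mg : measurable_fun [set: lebesgueT] g by exact: emeasurable_sum.
have cP P : S P ->
    (c%:E * lebesgue R n (cube_set P) <=
     \int[lebesgue R n]_(x in cube_set P) g x)%E.
  move=> SP; rewrite intg lebesgue_cube -EFinM lee_fin.
  have sP0 := exprn_gt0 n (side_gt0 P).
  have agm : \prod_i (mass i P / mass i Q) <=
      ((\sum_i mass i P / mass i Q) / m%:R) ^+ m.
    have := (leif_AGM (A := 'I_m) (E := fun i => mass i P / mass i Q)
      (fun i _ => divr_ge0 (mass_ge0 i P) (mass_ge0 i Q))).1.
    by rewrite card_ord.
  (* Clearing denominators in [cSQ] gives a bound on an [m]-th power, so an [m]-th root can be taken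
     after the mean inequality. *)
  have : (c * (side P ^+ n / side Q ^+ n)) ^+ m <=
      \prod_i (mass i P / mass i Q).
    have := cSQ P SP; rewrite !mean_prodE => cPQ.
    rewrite big_split/= prodfV ler_pdivlMr; last by apply: prodr_gt0.
    move: cPQ; rewrite ler_pdivlMr ?exprn_gt0 ?side_gt0// => cPQ.
    apply: le_trans cPQ; rewrite !exprMn exprVn le_eqVlt; apply/orP; left;
      apply/eqP. ring.
  move=> /le_trans/(_ agm); rewrite ler_pXn2r ?nnegrE//; last 2 first.
  - by rewrite mulr_ge0// divr_ge0// ltW.
  - rewrite divr_ge0 ?(ltW m0)// sumr_ge0// => i _.
    by rewrite divr_ge0 ?mass_ge0.
  rewrite mulrA ler_pdivrMr// => /le_trans; apply.
  rewrite -mulrA mulr_suml le_eqVlt; apply/orP; left; apply/eqP.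
  by apply: eq_bigr => i _; rewrite /w; ring.
have [mS cSg] := @le_measure_integral_bigcup _ lebesgueT _
  (lebesgue R n) _ _ _ _ _ cS tS (fun P _ => measurable_cube P) mg g0 c0 cP.
apply: le_trans cSg _; apply: (@le_trans _ _
    (\int[lebesgue R n]_(x in cube_set Q) g x)%E).
  apply: (ge0_subset_integral _ mS (measurable_cube Q)).
  - exact: measurable_funTS mg.
  - by move=> x _; exact: g0.
  - by move=> x [P /SQ]; exact.
rewrite intg lebesgue_cube lee_fin (eq_bigr (fun=> side Q ^+ n / m%:R)).
  by rewrite sumr_const card_ord -[_ *+ m]mulr_natr divfK ?gt_eqF.
by move=> i _; rewrite /w divfK ?gt_eqF.
Qed.

End averages.

(** * Maximal cubes above a level *)

Section stopping_cubes.
Context {R : realType} {m n : nat} (D : set (cube R n)).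
Context (f : 'I_m -> 'rV[R]_n -> R).
Hypotheses (m_gt0 : (0 < m)%N) (n_gt0 : (0 < n)%N) (gD : dyadic_grid D).
Hypothesis f_ge0 : forall i x, 0 <= f i x.
Hypothesis f_int : forall i, (lebesgue R n).-integrable setT (EFin \o f i).
Implicit Types (P Q : cube R n) (l : R).

Definition stopping l : set (cube R n) :=
  [set Q | [/\ D Q, l < mean_prod f Q &
    forall P, D P -> cube_set Q `<=` cube_set P -> side Q < side P ->
      mean_prod f P <= l]].

(** Meeting cubes are nested, and a strictly larger one above the level would violate the maximality
    of the smaller. *)
Lemma stopping_inj l P Q : stopping l P -> stopping l Q ->
  cube_set P `&` cube_set Q !=set0 -> P = Q.
Proof.
wlog sPQ : P Q / side P <= side Q.
  move=> W SP SQ PQ; have [sPQ|/ltW sQP] := leP (side P) (side Q).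
    exact: W.
  by apply/esym/W => //; rewrite setIC.
move=> [DP _ maxP] [DQ lQ _] PQ; apply: (dyadic_grid_inj gD) => //.
apply/eqP; rewrite eq_le sPQ/= leNgt; apply/negP => sPQ'.
have PQsub : cube_set P `<=` cube_set Q by exact: (dyadic_grid_sub _ gD).
by have := maxP Q DQ PQsub sPQ'; rewrite leNgt lQ.
Qed.

Lemma stopping_le l Q : stopping l Q ->
  mean_prod f Q <= 2 ^+ (m * n) * l.
Proof.
move=> [DQ _ maxQ].
have [P [DP sP QP]] := dyadic_grid_ancestor n_gt0 gD DQ 1.
rewrite expr1 in sP.
apply: le_trans (mean_prod_le_sub f_ge0 f_int _ sP QP) _; first exact: ltr0n.
rewrite ler_pM2l ?exprn_gt0// maxQ// sP.
by rewrite ltr_pMr ?side_gt0// ltr1n.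
Qed.

Lemma stopping_cover l Q : 0 < l -> D Q -> l < mean_prod f Q ->
  exists2 P, stopping l P & cube_set Q `<=` cube_set P.
Proof.
move=> l0 DQ lQ; have [D2 _ _] := gD.
have [M M0 massM] := mass_bounded f_ge0 f_int.
pose anc P j := [/\ D P, side P = side Q * 2 ^+ j,
  cube_set Q `<=` cube_set P & l < mean_prod f P].
pose p (j : nat) : bool := `[< exists P, anc P j >].
have p0 : exists j, p j.
  by exists 0%N; apply/asboolP; exists Q; split; rewrite ?expr0 ?mulr1.
pose s := (side Q ^+ n) ^+ m.
have s0 : 0 < s by rewrite !exprn_gt0 ?side_gt0.
(* An ancestor above the level at height [j] gives [l * s * 2 ^ (j * n * m) < M], and
   [j < 2 ^ j <= 2 ^ (j * n * m)]. *)
have pM j : p j -> (j <= Num.bound (M / s / l))%N.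
  move=> /asboolP[P [_ sP _]].
  rewrite mean_prodE sP !exprMn -/s => lP.
  have t0 : 0 < 2 ^+ j ^+ n ^+ m :> R by rewrite !exprn_gt0.
  rewrite ltr_pdivlMr ?mulr_gt0// in lP.
  rewrite ltnW// -(ltr_nat R).
  apply: le_lt_trans (archi_boundP _); last by rewrite !divr_ge0// ltW.
  rewrite !ler_pdivlMr//; apply: le_trans (ltW (lt_le_trans lP (massM P))).
  rewrite [s * _]mulrC mulrA [l * _]mulrC !ler_pM2r//.
  rewrite -!exprM -natrX ler_nat.
  apply: leq_trans (ltnW (ltn_expl j (ltnSn 1))) _.
  by rewrite leq_exp2l// leq_pmulr// muln_gt0 n_gt0.
have [j /asboolP[P [DP sP QP lP]] jmax] := ex_maxnP p0 pM.
exists P => //; split=> // P' DP' PP' sPP'; rewrite leNgt; apply/negP => lP'.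
have [k sPk] := D2 P DP; have [k' sPk'] := D2 P' DP'.
have kk' : k < k' by move: sPP'; rewrite sPk sPk' ltr_eXz2l ?ltr1n.
have [i ik] : exists i : nat, k' - k = i%:Z.
  by exists `|k' - k|%N; rewrite gez0_abs// subr_ge0 ltW.
have i0 : (0 < i)%N by rewrite -ltz_nat -ik subr_gt0.
(* The larger cube [P'] would be an ancestor of [Q] at height [j + i], beyond the maximal height
   [j]. *)
have : p (j + i)%N.
  apply/asboolP; exists P'; split=> //; last exact: subset_trans PP'.
  rewrite exprD mulrA -sP sPk sPk' exprnP -ik -exprzDr ?unitfE//.
  by rewrite addrC subrK.
by move=> /jmax; rewrite leqNgt -[X in (X < _)%N]addn0 ltn_add2l i0.
Qed.

(** If [P] were strictly larger it would contain [Q], and maximality of [Q] would give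
    [mean_prod f P <= l <= l']. *)
Lemma stopping_sub l l' P Q : l <= l' -> stopping l Q -> stopping l' P ->
  cube_set P `&` cube_set Q !=set0 -> cube_set P `<=` cube_set Q.
Proof.
move=> ll' [DQ lQ maxQ] [DP lP _] PQ.
have [sPQ|sQP] := leP (side P) (side Q); first exact: (dyadic_grid_sub _ gD).
have QP : cube_set Q `<=` cube_set P.
  by apply: (dyadic_grid_sub _ gD) => //; rewrite ?ltW// setIC.
by have := le_trans (maxQ P DP QP sQP) ll'; rewrite leNgt lP.
Qed.

Lemma stopping_maximal l : 0 < l ->
  upper_half_space `&` [set p | (l%:E < dyadic_maximal D f p)%E] =
  \bigcup_(Q in stopping l) (tent Q `|` tent_top Q).
Proof.
move=> l0; apply/seteqP; split => [[x t] [/= t0]|[x t] [Q [DQ lQ _]] xtQ].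
  move=> /ereal_sup_gt[_ [Q [DQ Qx tQ] <-]]; rewrite average_prodE// lte_fin.
  move=> /(stopping_cover l0 DQ)[P SP QP]; exists P => //.
  have := le_trans tQ (le_side_cube n_gt0 QP).
  (* Equality [t = side P] lands on the top face, strict inequality in the tent. *)
  rewrite /= le_eqVlt => /predU1P[tP|tP]; [right|left]; split=> //=.
  - exact: QP.
  - exact: QP.
  - by rewrite t0 tP.
have [Qx t0 tQ] : [/\ cube_set Q x, 0 <= t & t <= side Q].
  by case: xtQ => -[/= Qx]; [move=> /andP[t0 /ltW]|move=> ->; split=> //;
    rewrite ltW// side_gt0].
split=> //=; apply: lt_le_trans (_ : average_prod f Q <= _)%E.
  by rewrite average_prodE// lte_fin.
by apply: ereal_sup_ubound; exists Q.
Qed.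

(** This is [packing] with [c = 2]: the factor [2 ^+ (m * n)] absorbs the upper bound of
    [stopping_le], leaving [2 ^+ m] as the required gain [c ^+ m]. *)
Lemma stopping_half l l' Q : 0 < l -> 2 ^+ m * (2 ^+ (m * n) * l) <= l' ->
  stopping l Q ->
  (lebesgue R n (layer (stopping l') `&` cube_set Q) <=
   (2^-1)%:E * lebesgue R n (cube_set Q))%E.
Proof.
move=> l0 ll' SQ.
have le_ll' : l <= l'.
  apply: le_trans ll'; rewrite mulrA ler_peMl ?(ltW l0)//.
  by rewrite -exprD exprn_ege1// ler1n.
(* By [stopping_sub], a cube at level [l'] that meets [Q] lies inside it. *)
pose S := [set P | stopping l' P /\ cube_set P `<=` cube_set Q].
have -> : layer (stopping l') `&` cube_set Q = layer S.
  apply/seteqP; split => [x [[P SP Px] Qx]|x [P [SP PQ] Px]].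
    exists P => //; split=> //; apply: (stopping_sub le_ll' SQ SP).
    by exists x.
  by split; [exists P|exact: PQ].
rewrite lee_pdivlMl//; apply: (packing f_ge0 f_int) => //.
- apply: sub_countable (dyadic_grid_countable gD).
  by apply: subset_card_le => P [[]].
- by move=> P P' [SP _] [SP' _]; exact: stopping_inj SP SP'.
- by move=> P [].
- by have [_ /(lt_trans l0)] := SQ.
- move=> P [[_ /ltW lP _] _]; apply: le_trans lP; apply: le_trans ll'.
  by rewrite ler_pM2l ?exprn_gt0// stopping_le.
Qed.

End stopping_cubes.

Theorem lemma2p1 (R : realType) (m n : nat) (hm : (0 < m)%N) (hn : (0 < n)%N)
    (D : set (cube R n)) (hD : dyadic_grid D)
    (f : 'I_m -> 'rV[R]_n -> R)
    (f_ge0 : forall i x, 0 <= f i x)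
    (f_int : forall i, (lebesgue R n).-integrable setT (EFin \o f i)) :
  let a : R := 2 ^+ (m * n.+1) in
  exists S : int -> set (cube R n),
    (forall k : int,
      [/\ S k `<=` D,
          forall Q, S k Q ->
            ((a ^ k)%:E < average_prod f Q <= (2 ^+ (m * n) * a ^ k)%:E)%E,
          trivIset (S k) (fun Q => (tent Q)°)
        & upper_half_space `&` [set p | ((a ^ k)%:E < dyadic_maximal D f p)%E]
          = \bigcup_(Q in S k) (tent Q `|` tent_top Q)]) /\
    sparse S.
Proof.
move=> a; have a0 : 0 < a by rewrite exprn_gt0.
have ak0 k : 0 < a ^ k by exact: exprz_gt0.
(* The exponent [m * n.+1] splits as [m + m * n], matching the two factors in [stopping_half]. *)
have aS k : a ^ (k + 1) = 2 ^+ m * (2 ^+ (m * n) * a ^ k).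
  by rewrite exprzDr ?unitfE ?gt_eqF// expr1z mulrA -exprD -mulnS mulrC.
exists (fun k => stopping D f (a ^ k)); split=> [k|]; split.
- by move=> Q [].
- move=> Q SQ; rewrite average_prodE// lte_fin lee_fin.
  rewrite (stopping_le hn hD f_ge0 f_int SQ) andbT.
  by case: SQ.
(* Tents over distinct stopping cubes are disjoint already in their base points. *)
- move=> P Q SP SQ [p [/interior_subset[Pp _] /interior_subset[Qp _]]].
  by apply: (stopping_inj hn hD SP SQ); exists p.1.
- exact: stopping_maximal.
- by move=> k P Q; exact: stopping_inj.
- move=> k x [P [DP aP _] Px].
  have : a ^ k < mean_prod f P.
    apply: le_lt_trans aP; rewrite aS mulrA -exprD ler_peMl ?(ltW (ak0 k))//.
    by rewrite exprn_ege1// ler1n.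
  by move=> /(stopping_cover hm hn hD f_ge0 f_int (ak0 k) DP)[Q SQ PQ];
    exists Q => //; exact: PQ.
- move=> k Q SQ.
  by apply: (stopping_half hm hn hD f_ge0 f_int (ak0 k) _ SQ); rewrite aS.
Qed.
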